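(* Let $\mathcal{D}$ be a distribution on $\mathbb{R}^d$, $f$ a linear threshold function on $\mathbb{R}^d$, $q\ge2$ and $k\in\{1,\dots,q-1\}$, and let $\mathcal{M}$ be a collection of $m$ bags sampled i.i.d. from $\mathrm{Ex}(f,\mathcal{D},q,k)$. There is an absolute constant $C_0>0$ such that for any $\varepsilon<1/(4q)$ and $\delta>0$, if $m\ge C_0d(\log q+\log(1/\delta))/\varepsilon^2$, then with probability at least $1-\delta$ over $\mathcal{M}$, every linear threshold function $h$ on $\mathbb{R}^d$ with $\mathrm{BagErr}_{\mathrm{sample}}(h,\mathcal{M})\le\varepsilon$ satisfies: (i) if $k\neq q/2$, $\Pr_{\mathbf{x}\sim\mathcal{D}}[f(\mathbf{x})\neq h(\mathbf{x})]\le4\varepsilon$; and (ii) if $k=q/2$, $\Pr_{\mathbf{x}\sim\mathcal{D}}[f(\mathbf{x})\neq h(\mathbf{x})]\le4\varepsilon$ or $\Pr_{\mathbf{x}\sim\mathcal{D}}[f(\mathbf{x})\neq1-h(\mathbf{x})]\le4\varepsilon$.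
   Context: A linear threshold function (LTF) is $\mathbf{x}\mapsto\mathrm{pos}(\mathbf{r}^{\mathsf T}\mathbf{x}+c)$ with $\mathrm{pos}(a)=1$ if $a>0$ and $0$ otherwise. The bag oracle $\mathrm{Ex}(f,\mathcal{D},q,k)$ returns a bag $B=\{\mathbf{x}^{(1)},\dots,\mathbf{x}^{(q)}\}$ of independent points with $\mathbf{x}^{(i)}\sim\mathcal{D}_{f,1}$ for $i\le k$ and $\mathbf{x}^{(i)}\sim\mathcal{D}_{f,0}$ for $i>k$, where $\mathcal{D}_{f,a}$ is $\mathcal{D}$ conditioned on $f(\mathbf{x})=a$ (both events assumed to have positive probability). For a hypothesis $h$ and a collection $\mathcal{M}$ of $m$ bags, $\mathrm{BagErr}_{\mathrm{sample}}(h,\mathcal{M}):=|\{B\in\mathcal{M}:\mathrm{Avg}\{h(\mathbf{x}):\mathbf{x}\in B\}\neq k/q\}|/m$. *)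

(* Defs.v *)
From HB Require Import structures.
From mathcomp Require Import all_boot all_order all_algebra.
From mathcomp Require Import all_classical all_reals all_analysis.
From mathcomp Require Import Rstruct Rstruct_topology.
From Stdlib Require Import Rdefinitions.

Set Implicit Arguments.
Unset Strict Implicit.
Unset Printing Implicit Defensive.

Import Order.TTheory GRing.Theory Num.Theory.
Local Open Scope classical_set_scope.
Local Open Scope ring_scope.

Notation R := Rdefinitions.R.

Definition Rd (d : nat) := g_sigma_algebraType (@open 'rV[R]_d).

Definition pos (a : R) : R := if 0 < a then 1 else 0.

Definition ltf (d : nat) (r : 'rV[R]_d) (c : R) (x : Rd d) : R :=
  pos ((\sum_(i < d) r ord0 i * (x : 'rV[R]_d) ord0 i) + c).

Definition is_ltf (d : nat) (h : Rd d -> R) : Prop :=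
  exists (r : 'rV[R]_d) (c : R), forall x, h x = ltf r c x.

Definition cond_prob (d : nat) (D : probability (Rd d) R) (f : Rd d -> R)
  (a : R) (A : set (Rd d)) : R :=
  fine (D (A `&` [set x | f x = a])) / fine (D [set x | f x = a]).

Definition bag_avg (d q : nat) (h : Rd d -> R) (B : 'I_q -> Rd d) : R :=
  (\sum_(j < q) h (B j)) / q%:R.

Definition bag_err (d q k m : nat) (h : Rd d -> R)
  (M : 'I_m -> 'I_q -> Rd d) : R :=
  #|[set i : 'I_m | bag_avg h (M i) != k%:R / q%:R]|%:R / m%:R.

Definition disagree (d : nat) (D : probability (Rd d) R) (g1 g2 : Rd d -> R) : R :=
  fine (D [set x | g1 x <> g2 x]).

Definition mutually_independent {dO} {O : measurableType dO} (P : probability O R)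
  (d m q : nat) (X : 'I_m -> 'I_q -> O -> Rd d) : Prop :=
  forall (J : {set 'I_m * 'I_q}) (A : 'I_m -> 'I_q -> set (Rd d)),
    (forall i j, measurable (A i j)) ->
    fine (P [set w | forall p, p \in J -> A p.1 p.2 (X p.1 p.2 w)]) =
    \prod_(p in J) fine (P (X p.1 p.2 @^-1` A p.1 p.2)).

(* M = (X i j)_{i,j} is a collection of m bags sampled i.i.d. from
   Ex(f, D, q, k): all points independent, point j of every bag has law
   D_{f,1} if j < k (i.e. j+1 <= k) and D_{f,0} otherwise. *)
Definition bags_from_oracle {dO} {O : measurableType dO} (P : probability O R)
  (d : nat) (D : probability (Rd d) R) (f : Rd d -> R) (q k m : nat)
  (X : 'I_m -> 'I_q -> O -> Rd d) : Prop :=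
  (forall i j, measurable_fun setT (X i j)) /\
  mutually_independent P X /\
  (forall i j (A : set (Rd d)), measurable A ->
     fine (P (X i j @^-1` A)) =
     cond_prob D f (if ltn (nat_of_ord j) k then 1 else 0) A).

(* Main.v *)
Require Import Defs.
From mathcomp Require Import Rstruct Rstruct_topology.
From mathcomp Require Import all_boot all_order all_algebra.
From mathcomp Require Import all_classical all_reals all_analysis.
From mathcomp Require Import ring lra zify.

Set Implicit Arguments.
Unset Strict Implicit.
Unset Printing Implicit Defensive.

Import Order.TTheory GRing.Theory Num.Theory.
Import numFieldNormedType.Exports.
Local Open Scope ring_scope.

(* Let [s1], [s0] be the probabilities that [h] outputs 1 on a positive,
   respectively negative, point.  A bag is misjudged with probability at most
   [4 eps < 1/2] only if each of [s1], [s0] is within [4 eps] of 0 or 1 and the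
   most likely label vector of a bag has exactly [k] ones: this forces [h] to be
   [4 eps]-close to [f], or to [1 - f] when [k = q/2].

   It remains to see that, outside an event of probability [delta], no [h] whose
   true bag error exceeds [4 eps] has sample bag error at most [eps].  This is a
   relative deviation bound: symmetrization with a ghost sample, then random
   swaps, give a failure probability [2 G exp (- 5 eps m / 32)], where [G] bounds
   the number of labelings of [2 m q] points by halfspaces.  Cover's recursion
   gives [G <= (1+t)^(2mq) / t^(d+1)] for every [t] in (0,1]; with
   [t = eps / (32 q)] no logarithm of [m] appears.

   Halfspaces with rational coefficients approximate every halfspace pointwise,
   so only countably many hypotheses matter.  For the first [N] of them a point
   matters only through its pattern of [N] labels; the sample then takes
   finitely many values, and the whole symmetrization, ghost sample included,
   is a computation with finite sums. *)

(** * Labelings by halfspaces *)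

Definition restrictions (T : Type) (J V : finType) (h : J -> T -> bool) (Q : {set J})
    (y : V -> T) : {set {ffun V -> bool}} :=
  [set [ffun p => h n (y p)] | n in Q].

Section Labelings.
Variables (K : realFieldType) (D : nat).
Implicit Types (v : 'rV[K]_D) (y : 'cV[K]_D) (U : 'M[K]_D).

Definition positive_on v y : bool := 0 < (v *m y) ord0 ord0.

Definition labelings n (s : n.-tuple 'cV[K]_D) U : {set n.-tuple bool} :=
  [set l | `[< exists2 v, (v <= U)%MS & l = map_tuple (positive_on v) s >]].

Definition tails n (b : bool) (L : {set n.+1.-tuple bool}) : {set n.-tuple bool} :=
  [set l : n.-tuple bool | [tuple of b :: l] \in L].

Lemma card_tails n (L : {set n.+1.-tuple bool}) :
  #|L| = (#|tails true L :|: tails false L| + #|tails true L :&: tails false L|)%N.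
Proof.
rewrite cardsUI.
have cons_inj b : injective (fun l : n.-tuple bool => [tuple of b :: l]).
  by move=> l l' /(congr1 val) [] /val_inj.
have card_heads b : #|tails b L| = #|[set l in L | thead l == b]|.
  rewrite -(card_imset _ (cons_inj b)); apply: eq_card => l; rewrite [RHS]inE.
  apply/imsetP/andP => [[l' + ->]|[lL /eqP <-]]; first by rewrite inE.
  by exists (behead_tuple l); rewrite ?inE -?tuple_eta.
rewrite !card_heads -(cardsID [set l : n.+1.-tuple bool | thead l]).
by congr addn; apply: eq_card => l; rewrite !inE ?eqb_id ?eqbF_neg// andbC.
Qed.

Lemma mem_tails_labelings n b y (s : n.-tuple 'cV[K]_D) U l :
  l \in tails b (labelings [tuple of y :: s] U) ->
  exists2 v, (v <= U)%MS & positive_on v y = b /\ l = map_tuple (positive_on v) s.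
Proof.
rewrite !inE => -[v vU /(congr1 val)/= [bE lE]].
by exists v => //; split; [|exact: val_inj].
Qed.

Lemma positive_on_crossing n v1 v2 y (s : n.-tuple 'cV[K]_D) U :
  (v1 <= U)%MS -> (v2 <= U)%MS -> positive_on v1 y -> ~~ positive_on v2 y ->
  map_tuple (positive_on v1) s = map_tuple (positive_on v2) s ->
  map_tuple (positive_on v1) s \in labelings s (U :&: kermx y)%MS.
Proof.
rewrite /positive_on -leNgt => v1U v2U v1y v2y /(congr1 val) /= eq12.
set a1 := (v1 *m y) ord0 ord0 in v1y; set a2 := (v2 *m y) ord0 ord0 in v2y.
have mulE c1 c2 (z : 'cV_D) : ((c1 *: v1 + c2 *: v2) *m z) ord0 ord0 =
    c1 * (v1 *m z) ord0 ord0 + c2 * (v2 *m z) ord0 ord0.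
  by rewrite mulmxDl -!scalemxAl !mxE.
rewrite !inE; exists ((- a2) *: v1 + a1 *: v2).
  rewrite sub_capmx addmx_sub ?scalemx_sub //=; apply/sub_kermxP.
  by apply/matrixP => i j; rewrite !ord1 mulE -/a1 -/a2 mxE; ring.
apply: val_inj; apply: (iffLR (eq_in_map _ _ _)) => z zs; rewrite /positive_on mulE.
have /(_ z zs) := iffRL (eq_in_map _ _ _) eq12.
case: (ltP 0 ((v1 *m z) _ _)) => z1; case: (ltP 0 ((v2 *m z) _ _)) => z2 // _.
  by apply/esym; nra.
by apply/esym/negbTE; rewrite -leNgt; nra.
Qed.

Lemma sub_tails_labelingsU n y (s : n.-tuple 'cV[K]_D) U
    (L := labelings [tuple of y :: s] U) :
  tails true L :|: tails false L \subset labelings s U.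
Proof.
apply/fintype.subsetP => l; rewrite inE => /orP[] /mem_tails_labelings[v vU [_ ->]];
by rewrite !inE; exists v.
Qed.

Lemma sub_tails_labelingsI n y (s : n.-tuple 'cV[K]_D) U
    (L := labelings [tuple of y :: s] U) :
  tails true L :&: tails false L \subset labelings s (U :&: kermx y)%MS.
Proof.
apply/fintype.subsetP => l; rewrite inE => /andP[].
move=> /mem_tails_labelings[v1 v1U [v1y ->]] /mem_tails_labelings[v2 v2U [v2y eq12]].
by apply: positive_on_crossing eq12; rewrite ?v1y ?v2y.
Qed.

Lemma tails_labelings_rank n y (s : n.-tuple 'cV[K]_D) U :
  tails true (labelings [tuple of y :: s] U) != finset.set0 ->
  (\rank (U :&: kermx y) < \rank U)%N.
Proof.
move=> /set0Pn[l /mem_tails_labelings[v vU [vy _]]].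
apply: rank_ltmx; rewrite ltmxE capmxSl /=; apply/negP => /(submx_trans vU).
rewrite sub_capmx => /andP[_ /sub_kermxP vy0].
by move: vy; rewrite /positive_on vy0 mxE ltxx.
Qed.

(* Cover's recursion: with [N n r] the largest number of labelings of [n] points
   in rank [r], [N n.+1 r.+1 <= N n r.+1 + N n r]. *)
Lemma card_labelings_le (t : K) n (s : n.-tuple 'cV[K]_D) U :
  0 < t <= 1 -> #|labelings s U|%:R * t ^+ \rank U <= (1 + t) ^+ n.
Proof.
move=> /andP[t0 t1]; have t0' := ltW t0; elim: n s U => [|n IH] s U.
  rewrite expr0 -[leRHS]mul1r ler_pM// ?exprn_ge0 ?exprn_ile1// lern1.
  by apply: leq_trans (max_card _) _; rewrite card_tuple expn0.
case/tupleP: s => y s; rewrite card_tails; set L := labelings _ U.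
have cardU : #|tails true L :|: tails false L|%:R * t ^+ \rank U <= (1 + t) ^+ n.
  apply: le_trans (IH s U); rewrite ler_wpM2r ?exprn_ge0// ler_nat.
  exact/subset_leq_card/sub_tails_labelingsU.
have cardI :
    #|tails true L :&: tails false L|%:R * t ^+ \rank U <= t * (1 + t) ^+ n.
  have [->|nonempty] := eqVneq (tails true L) finset.set0.
    by rewrite finset.set0I cards0 mul0r mulr_ge0 ?exprn_ge0 ?addr_ge0.
  rewrite -(subnKC (tails_labelings_rank nonempty)) addSn exprS mulrCA ler_pM2l//.
  apply: le_trans (IH s (U :&: kermx y)%MS); rewrite exprD mulrA.
  apply: le_trans (ler_piMr _ _) _; rewrite ?exprn_ile1 ?mulr_ge0 ?exprn_ge0//.
  rewrite ler_wpM2r ?exprn_ge0// ler_nat.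
  exact/subset_leq_card/sub_tails_labelingsI.
by rewrite natrD mulrDl exprS mulrDl mul1r lerD.
Qed.

Lemma card_positive_on_le (t : K) (V J : finType) (y : V -> 'cV[K]_D)
    (v : J -> 'rV[K]_D) (Q : {set J}) :
  0 < t <= 1 ->
  #|restrictions (fun n => positive_on (v n)) Q y|%:R <= (1 + t) ^+ #|V| / t ^+ D.
Proof.
move=> t01; have /andP[t0 _] := t01; rewrite ler_pdivlMr ?exprn_gt0//.
have := card_labelings_le [tuple y (enum_val i) | i < #|V|] 1%:M t01.
rewrite mxrank1; apply: le_trans; rewrite ler_wpM2r ?exprn_ge0 ?(ltW t0)// ler_nat.
pose to_tuple (f : {ffun V -> bool}) := [tuple f (enum_val i) | i < #|V|].
have to_tuple_inj : injective to_tuple.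
  move=> f g fg; apply/ffunP => i.
  have := congr1 (fun l => tnth l (enum_rank i)) fg.
  by rewrite !tnth_mktuple enum_rankK.
rewrite -(card_imset _ to_tuple_inj); apply/subset_leq_card/fintype.subsetP => l.
move=> /imsetP[f /imsetP[n _ ->] ->]; rewrite !inE.
exists (v n); first exact: submx1.
by apply: eq_from_tnth => i; rewrite tnth_mktuple ffunE tnth_map tnth_mktuple.
Qed.
End Labelings.

(** * Sums of independent bits *)

Section ProductWeight.
Variables (K : numDomainType) (I T : finType) (mu : I -> T -> K).
Implicit Type z : {ffun I -> T}.

Definition product_weight z : K := \prod_i mu i (z i).

Lemma product_weight_ge0 z : (forall i x, 0 <= mu i x) -> 0 <= product_weight z.
Proof. by move=> mu_ge0; apply: prodr_ge0. Qed.

Lemma sum_product_weight :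
  (forall i, \sum_x mu i x = 1) -> \sum_z product_weight z = 1.
Proof. by move=> mu_sum1; rewrite -bigA_distr_bigA big1. Qed.
End ProductWeight.

Section BernoulliSums.
Variable K : realFieldType.
Implicit Types (p : {poly K}) (a : K).

Definition bernoulli_poly a : {poly K} := (1 - a)%:P + a *: 'X.

Lemma coef_mul_bernoulli_poly a p k :
  (bernoulli_poly a * p)`_k =
  (1 - a) * p`_k + (if k is k'.+1 then a * p`_k' else 0).
Proof.
rewrite /bernoulli_poly mulrDl coefD mul_polyC coefZ -scalerAl coefZ coefXM.
by case: k => [|k] //=; rewrite mulr0.
Qed.

Lemma coef_bernoulli_prod (I T : finType) (mu : I -> T -> K) (g : T -> bool) k :
  (forall i, \sum_x mu i x = 1) ->
  (\prod_i bernoulli_poly (\sum_(x | g x) mu i x))`_k =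
  \sum_(z : {ffun I -> T} | (\sum_i g (z i))%N == k) product_weight mu z.
Proof.
move=> mu_sum1; have bernoulliE i :
    bernoulli_poly (\sum_(x | g x) mu i x) = \sum_x mu i x *: 'X^(g x).
  rewrite /bernoulli_poly -(mu_sum1 i) (bigID g predT)/= [X in X - _]addrC addrK.
  rewrite [RHS](bigID g)/= [LHS]addrC raddf_sum scaler_suml; congr (_ + _).
    by apply: eq_bigr => x ->.
  by apply: eq_bigr => x /negbTE ->; rewrite -mul_polyC mulr1.
rewrite (eq_bigr _ (fun i _ => bernoulliE i)) bigA_distr_bigA.
rewrite (eq_bigr (fun z : {ffun I -> T} =>
  product_weight mu z *: 'X^(\sum_i g (z i)))) => [|z _]; first exact: coef_sumMXn.
by rewrite scaler_prod prodrXr.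
Qed.

Definition pairwise_subprobability p :=
  (forall i, 0 <= p`_i) /\ (forall i j, i != j -> p`_i + p`_j <= 1).

Lemma pairwise_subprobability_le1 p i : pairwise_subprobability p -> p`_i <= 1.
Proof.
case=> p_ge0 p_pair; apply: le_trans (p_pair i i.+1 _); rewrite ?lerDl//.
by rewrite neq_ltn ltnSn.
Qed.

Lemma pairwise_subprobability_prod (I : Type) (r : seq I) (Q : pred I) (a : I -> K) :
  (forall i, 0 <= a i <= 1) ->
  pairwise_subprobability (\prod_(i <- r | Q i) bernoulli_poly (a i)).
Proof.
move=> a01; apply: big_rec => [|i p _ sub_p].
  split=> [i|i j ij]; rewrite !coef1 ?ler0n// -natrD lern1.
  by case: i j ij => [|i] [|j].
have /andP[a0 a1] := a01 i; have b0 : 0 <= 1 - a i by rewrite subr_ge0.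
have p_le1 k := @pairwise_subprobability_le1 p k sub_p; have [p_ge0 p_pair] := sub_p.
split=> [k|k l kl]; rewrite !coef_mul_bernoulli_poly.
  by case: k => [|k]; rewrite addr_ge0// mulr_ge0.
have pkl := p_pair _ _ kl; case: k l kl pkl => [|k] [|l] //= kl pkl.
- by have := p_le1 l; nra.
- by have := p_le1 k; nra.
- by have := p_pair k l kl; nra.
Qed.

Lemma coef_bernoulli_prod_le_max (I : finType) (a : I -> K) (i : I) k :
  (forall i, 0 <= a i <= 1) ->
  (\prod_i bernoulli_poly (a i))`_k <= Num.max (a i) (1 - a i).
Proof.
move=> a01; rewrite (bigD1 i)//= coef_mul_bernoulli_poly.
have sub_p := pairwise_subprobability_prod (index_enum I) (fun j => j != i) a01.
set p := \prod_(_ | _) _ in sub_p *.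
have p_le1 l := @pairwise_subprobability_le1 p l sub_p.
have [p_ge0 p_pair] := sub_p; have /andP[a0 a1] := a01 i.
have [a_le b_le] :
    a i <= Num.max (a i) (1 - a i) /\ 1 - a i <= Num.max (a i) (1 - a i).
  by rewrite !le_max !lexx orbT.
set m := Num.max _ _ in a_le b_le *; case: k => [|k].
  by have := p_le1 0; have := p_ge0 0; nra.
have kSk : k.+1 != k by rewrite neq_ltn ltnSn orbT.
by have := p_pair _ _ kSk; have := p_ge0 k; have := p_ge0 k.+1; nra.
Qed.

(* The excluded [k] is the value of the sum at the most likely outcome. *)
Lemma coef_bernoulli_prod_le_half (I : finType) (a : I -> K) k :
  (forall i, 0 <= a i <= 1) -> k != (\sum_i (1 / 2 <= a i)%R)%N ->
  (\prod_i bernoulli_poly (a i))`_k <= 1 / 2.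
Proof.
move=> a01; elim: (index_enum I) k => [|i r IH] k.
  by rewrite !big_nil coef1 => /negbTE ->; rewrite /=; lra.
rewrite !big_cons coef_mul_bernoulli_poly.
have sub_p := pairwise_subprobability_prod r predT a01; have [p_ge0 p_pair] := sub_p.
set p := \prod_(_ <- r) _ in IH sub_p p_ge0 p_pair *.
set c := (\sum_(_ <- r) _)%N in IH *.
have p_le1 l := @pairwise_subprobability_le1 p l sub_p.
have pS l : p`_l.+1 + p`_l <= 1 by apply: p_pair; rewrite neq_ltn ltnSn orbT.
have /andP[a0 a1] := a01 i; case: leP => /= ai.
  case: k => [_|k]; first by have := p_ge0 0; have := p_le1 0; nra.
  rewrite add1n eqSS => kc; have pk := IH _ kc.
  have [_|/IH pSk] := eqVneq k.+1 c; last by nra.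
  by have := pS k; nra.
rewrite add0n => kc; have pk := IH _ kc.
case: k kc pk => [|k] _ pk; first by have := p_ge0 0; nra.
have [_|/IH pk'] := eqVneq k c; last by nra.
by have := pS k; nra.
Qed.

Lemma bernoulli_prod_concentration (I : finType) (A : {set I}) (s : bool -> K)
    (eta : K) :
  (0 < #|A| < #|I|)%N -> (forall b, 0 <= s b <= 1) -> eta < 1 / 2 ->
  1 - eta <= (\prod_i bernoulli_poly (s (i \in A)))`_#|A| ->
  (1 - s true <= eta /\ s false <= eta) \/
  [/\ #|A|.*2 = #|I|, s true <= eta & 1 - s false <= eta].
Proof.
rewrite -(cardsC A) => A_proper s01 eta2 coef_ge; have si01 i := s01 (i \in A).
have [A_gt0 AC_gt0] : (0 < #|A|)%N /\ (0 < #|~: A|)%N by lia.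
have near01 b : s b <= eta \/ 1 - s b <= eta.
  have [i <-] : exists i, (i \in A) = b.
    case: b; first by have /card_gt0P := A_gt0.
    by have /card_gt0P[i] := AC_gt0; rewrite inE => /negbTE; exists i.
  have := le_trans coef_ge (coef_bernoulli_prod_le_max i #|A| si01).
  by rewrite le_max => /orP[]; [right|left]; lra.
have mode : #|A| = (#|A| * (1 / 2 <= s true)%R + #|~: A| * (1 / 2 <= s false)%R)%N.
  have <- : (\sum_i (1 / 2 <= s (i \in A))%R =
      #|A| * (1 / 2 <= s true)%R + #|~: A| * (1 / 2 <= s false)%R)%N.
    rewrite (bigID (mem A))/= -!sum_nat_const; congr addn.
      by apply: eq_bigr => i ->.
    by apply: eq_big => i; rewrite ?inE// => /negbTE ->.
  apply/eqP/contraT => /(coef_bernoulli_prod_le_half si01)/(le_trans coef_ge).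
  lra.
move: mode; have := near01 true; have := near01 false.
case: (leP (1 / 2) (s true)) => half1; case: (leP (1 / 2) (s false)) => half0 /=;
  move=> near0 near1 mode.
- by lia.
- by left; lra.
- by right; split; [lia|lra|lra].
- by lia.
Qed.
End BernoulliSums.

(** * Symmetrization *)

Local Notation double_sample I T := ({ffun I -> T} * {ffun I -> T})%type.

Section Chernoff.
Variables (K : realType) (I Z : finType) (nu : Z -> K).
Hypothesis nu_ge0 : forall x, 0 <= nu x.
Hypothesis nu_sum1 : \sum_x nu x = 1.
Implicit Types (z : {ffun I -> Z}) (E : pred Z).

Definition hits E z : nat := (\sum_i E (z i))%N.

Lemma mgf_event_le E (l : K) :
  \sum_x nu x * expR (- l * (E x)%:R) <=
  expR (- (1 - expR (- l)) * \sum_(x | E x) nu x).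
Proof.
apply: le_trans (expR_ge1Dx _); rewrite (bigID E)/=.
under eq_bigr => x Ex do rewrite Ex mulr1.
under [X in _ + X <= _]eq_bigr => x Ex do rewrite (negbTE Ex) mulr0 expR0 mulr1.
by have := nu_sum1; rewrite (bigID E)/= -mulr_suml; lra.
Qed.

Lemma hits_chernoff E (l a : K) : 0 <= l ->
  \sum_(z | (hits E z)%:R <= a) product_weight (fun=> nu) z <=
  expR (l * a - (1 - expR (- l)) * (#|I|%:R * \sum_(x | E x) nu x)).
Proof.
move=> l0; pose tilted x := nu x * expR (- l * (E x)%:R).
have tilted_ge0 x : 0 <= tilted x by rewrite mulr_ge0 ?expR_ge0.
have tilt z : (hits E z)%:R <= a ->
    product_weight (fun=> nu) z <= expR (l * a) * product_weight (fun=> tilted) z.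
  move=> hits_le; rewrite [X in _ * X]big_split /= -expR_sum -mulr_sumr -natr_sum.
  rewrite mulrCA -expRD ler_peMr ?product_weight_ge0// -[leLHS]expR0 ler_expR.
  by rewrite mulNr subr_ge0 ler_wpM2l.
apply: le_trans (ler_sum _ tilt) _; rewrite -mulr_sumr expRD ler_wpM2l ?expR_ge0//.
apply: (@le_trans _ _ (\sum_z product_weight (fun _ : I => tilted) z)).
  rewrite [leLHS]big_mkcond; apply: ler_sum => z _.
  by case: ifP => // _; exact: product_weight_ge0.
rewrite -bigA_distr_bigA prodr_const -mulNr mulrCA expRM_natl.
by rewrite lerXn2r ?nnegrE ?expR_ge0 ?sumr_ge0// mgf_event_le.
Qed.

Lemma many_hits_ge_half E (M : K) :
  3 <= M -> 4 * M <= #|I|%:R * \sum_(x | E x) nu x ->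
  1 / 2 <= \sum_(z | 2 * M <= (hits E z)%:R) product_weight (fun=> nu) z.
Proof.
move=> M3 M4; have expR_half : expR (- (1 / 2)) <= 2 / 3 :> K.
  have inv : expR (- (1 / 2)) * expR (1 / 2) = 1 :> K by rewrite -expRD addNr expR0.
  by have := expR_ge1Dx (1 / 2 : K); have := expR_gt0 (- (1 / 2) : K); nra.
have expR1 : expR (- 1) <= 1 / 2 :> K.
  by rewrite expRN div1r lef_pV2 ?posrE ?expR_gt0//; exact: expR_ge1Dx.
have few : \sum_(z | (hits E z)%:R <= 2 * M) product_weight (fun=> nu) z <= 1 / 2.
  have half_ge0 : 0 <= 1 / 2 :> K by lra.
  apply: le_trans (hits_chernoff E (2 * M) half_ge0) (le_trans _ expR1).
  by rewrite ler_expR; nra.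
have := sum_product_weight (mu := fun _ : I => nu) (fun=> nu_sum1).
rewrite (bigID (fun z => (hits E z)%:R <= 2 * M))/= => total.
suff : \sum_(z | ~~ ((hits E z)%:R <= 2 * M)) product_weight (fun=> nu) z <=
    \sum_(z | 2 * M <= (hits E z)%:R) product_weight (fun=> nu) z by lra.
rewrite [leLHS]big_mkcond [leRHS]big_mkcond; apply: ler_sum => z _ /=.
case: (leP _ (2 * M)) => [_|/ltW ->//].
by case: ifP => // _; exact: product_weight_ge0.
Qed.
End Chernoff.

Lemma ghost_sample_le (K : realFieldType) (S J : finType) (w : S -> K) (Q : {set J})
    (A B : J -> pred S) :
  (forall z, 0 <= w z) -> (forall n, n \in Q -> 1 / 2 <= \sum_(z | B n z) w z) ->
  \sum_(z | [exists n in Q, A n z]) w z <=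
  2 * \sum_(u : S * S | [exists n in Q, A n u.1 && B n u.2]) w u.1 * w u.2.
Proof.
move=> w_ge0 likely; rewrite big_mkcond mulr_sumr.
rewrite -(pair_big_dep xpredT (fun z z' => [exists n in Q, A n z && B n z'])
  (fun z z' => 2 * (w z * w z')))/=.
apply: ler_sum => z _; case: ifP => [/exists_inP[n nQ Anz]|_]; last first.
  by apply: sumr_ge0 => z' _; rewrite !mulr_ge0.
rewrite -mulr_sumr -mulr_sumr mulrCA ler_peMr//.
apply: (@le_trans _ _ (2 * \sum_(z' | B n z') w z')).
  by have := likely n nQ; lra.
rewrite ler_pM2l// [leLHS]big_mkcond [leRHS]big_mkcond; apply: ler_sum => z' _.
case: ifP => [Bnz'|_]; last by case: ifP.
by rewrite ifT//; apply/exists_inP; exists n; rewrite // Anz.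
Qed.

Section Swap.
Variables (I T : finType).
Implicit Types (s : {ffun I -> bool}) (u : double_sample I T).

Definition swap s u : double_sample I T :=
  ([ffun i => if s i then u.2 i else u.1 i],
   [ffun i => if s i then u.1 i else u.2 i]).

Lemma swapK s : involutive (swap s).
Proof.
by move=> [z z']; congr pair; apply/ffunP => i; rewrite !ffunE /=; case: (s i).
Qed.

Lemma product_weight_swap (K : numDomainType) (mu : I -> T -> K) s u :
  product_weight mu (swap s u).1 * product_weight mu (swap s u).2 =
  product_weight mu u.1 * product_weight mu u.2.
Proof.
rewrite -!big_split; apply: eq_bigr => i _ /=; rewrite !ffunE.
by case: (s i) => //; rewrite mulrC.
Qed.

Lemma sum_swaps (K : numDomainType) (mu : I -> T -> K)
    (A : pred (double_sample I T)) :
  2 ^+ #|I| * \sum_(u | A u) product_weight mu u.1 * product_weight mu u.2 =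
  \sum_u #|[set s | A (swap s u)]|%:R *
    (product_weight mu u.1 * product_weight mu u.2).
Proof.
pose W (u : double_sample I T) := product_weight mu u.1 * product_weight mu u.2.
have swapped s : \sum_(u | A u) W u = \sum_(u | A (swap s u)) W u.
  rewrite (reindex_inj (inv_inj (swapK s))).
  by apply: eq_bigr => u _; exact: product_weight_swap.
transitivity (\sum_(s : {ffun I -> bool}) \sum_(u | A (swap s u)) W u).
  rewrite -(eq_bigr _ (fun s _ => swapped s)) sumr_const.
  by rewrite card_ffun card_bool -natrX mulr_natl.
rewrite (exchange_big_dep xpredT)//=; apply: eq_bigr => u _.
by rewrite sumr_const mulr_natl; congr (_ *+ _); apply: eq_card => s; rewrite inE.
Qed.
End Swap.

Lemma leq_card_bigcup (I T : finType) (P : pred I) (F : I -> {set T}) :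
  (#|\bigcup_(i | P i) F i| <= \sum_(i | P i) #|F i|)%N.
Proof.
elim/big_rec2: _ => [|i n A _ le_An]; first by rewrite cards0.
by apply: leq_trans (leq_card_setU _ _) _; rewrite leq_add2l.
Qed.

Section Skewed.
Variables (K : realType) (I : finType) (M : K).
Hypothesis M_ge0 : 0 <= M.

Definition skewed (T : finType) (E : pred T) (u : double_sample I T) : bool :=
  ((hits E u.1)%:R <= M) && (2 * M <= (hits E u.2)%:R).

(* The factors 2/3 and 4/3 average to at most 1 over the two orders of any pair of
   bits, while [(4/3)^2 * (2/3) > 1]. *)
Definition skew (b : double_sample I bool) : K :=
  (2 / 3) ^+ hits id b.1 * (4 / 3) ^+ hits id b.2.

Lemma sum_skew_swap (b : double_sample I bool) :
  \sum_s skew (swap s b) <= 2 ^+ #|I|.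
Proof.
pose bit_skew (i : I) (c : bool) : K :=
  (2 / 3) ^+ (if c then b.2 i else b.1 i) * (4 / 3) ^+ (if c then b.1 i else b.2 i).
rewrite (eq_bigr (fun s : {ffun I -> bool} => \prod_i bit_skew i (s i))); last first.
  move=> s _; rewrite /skew /hits -!prodrXr -big_split.
  by apply: eq_bigr => i _; rewrite !ffunE.
rewrite -bigA_distr_bigA -prodr_const; apply: ler_prod => i _.
rewrite big_bool /bit_skew.
by case: (b.1 i); case: (b.2 i); rewrite /= ?expr0 ?expr1; lra.
Qed.

Lemma skewed_skew (b : double_sample I bool) :
  skewed id b -> expR (5 / 32 * M) <= skew b.
Proof.
rewrite /skewed /skew => /andP[].
move: (hits id b.1) (hits id b.2) => n1 n2 n1_le n2_ge.
have pos23 : 0 < 2 / 3 :> K by lra.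
have pos43 : 0 < 4 / 3 :> K by lra.
have ln43_ge0 : 0 <= ln (4 / 3 : K) by rewrite ln_ge0//; lra.
have ln23_le0 : ln (2 / 3 : K) <= 0 by rewrite ln_le0//; lra.
have gain : 5 / 32 <= ln (2 / 3 : K) + 2 * ln (4 / 3).
  have -> : ln (2 / 3 : K) + 2 * ln (4 / 3) = - ln (1 + - (5 / 32)).
    rewrite (_ : 2 * ln (4 / 3) = ln (4 / 3) + ln (4 / 3)); last lra.
    rewrite -!lnM ?posrE ?mulr_gt0// -lnV ?posrE; last lra.
    by congr ln; rewrite (_ : 1 + - (5 / 32) = 27 / 32) ?invf_div; lra.
  by have := @le_ln1Dx K (- (5 / 32)); lra.
have pow_expR (x : K) n : 0 < x -> x ^+ n = expR (n%:R * ln x).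
  by move=> x0; rewrite expRM_natl lnK ?posrE.
rewrite !pow_expR// -expRD ler_expR.
have := ler_wnM2r ln23_le0 n1_le; have := ler_wpM2r ln43_ge0 n2_ge.
by have := ler_wpM2r M_ge0 gain; lra.
Qed.

Lemma card_skewed_swap (b : double_sample I bool) :
  #|[set s | skewed id (swap s b)]|%:R <= expR (- (5 / 32 * M)) * 2 ^+ #|I|.
Proof.
rewrite -ler_pdivrMl ?expR_gt0// -expRN opprK.
apply: le_trans (sum_skew_swap b); rewrite -sum1dep_card natr_sum mulr_sumr.
rewrite big_mkcond; apply: ler_sum => s _; case: ifP => [/skewed_skew|_].
  by rewrite mulr1.
by rewrite mulr_ge0 ?exprn_ge0//; lra.
Qed.

Definition trace (T : finType) (E : pred T) (u : double_sample I T) :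
    double_sample I bool :=
  ([ffun i => E (u.1 i)], [ffun i => E (u.2 i)]).

Lemma skewed_trace (T : finType) (E : pred T) s u :
  skewed id (swap s (trace E u)) = skewed E (swap s u).
Proof.
have [hits1 hits2] : hits id (swap s (trace E u)).1 = hits E (swap s u).1 /\
    hits id (swap s (trace E u)).2 = hits E (swap s u).2.
  by split; apply: eq_bigr => i _; rewrite !ffunE; case: (s i).
by rewrite /skewed hits1 hits2.
Qed.

Lemma card_skewed_swaps (T J : finType) (E : J -> pred T) (Q : {set J}) u :
  #|[set s | [exists n in Q, skewed (E n) (swap s u)]]|%:R <=
  #|[set trace (E n) u | n in Q]|%:R * (expR (- (5 / 32 * M)) * 2 ^+ #|I|).
Proof.
rewrite mulr_natl -[leRHS]sumr_const.
apply: le_trans _ (ler_sum _ (fun b _ => card_skewed_swap b)).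
rewrite -natr_sum ler_nat; apply: leq_trans _ (leq_card_bigcup _ _).
apply/subset_leq_card/fintype.subsetP => s; rewrite inE => /exists_inP[n nQ skew_n].
apply/finset.bigcupP; exists (trace (E n) u); first exact: imset_f.
by rewrite inE skewed_trace.
Qed.
End Skewed.

Lemma uniform_hits_bound (K : realType) (I Z J : finType) (nu : Z -> K)
    (E : J -> pred Z) (Q : {set J}) (M G : K) :
  (forall x, 0 <= nu x) -> \sum_x nu x = 1 -> 3 <= M ->
  (forall n, n \in Q -> 4 * M <= #|I|%:R * \sum_(x | E n x) nu x) ->
  (forall u : double_sample I Z,
     (forall i, nu (u.1 i) != 0) -> (forall i, nu (u.2 i) != 0) ->
     #|[set trace (E n) u | n in Q]|%:R <= G) ->
  \sum_(z : {ffun I -> Z} | [exists n in Q, (hits (E n) z)%:R <= M])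
     product_weight (fun=> nu) z <= 2 * G * expR (- (5 / 32 * M)).
Proof.
move=> nu_ge0 nu_sum1 M3 heavy few_traces; have M0 : 0 <= M by lra.
set w := product_weight (fun=> nu).
have w_ge0 (z : {ffun I -> Z}) : 0 <= w z by exact: product_weight_ge0.
have likely n : n \in Q -> 1 / 2 <= \sum_(z | 2 * M <= (hits (E n) z)%:R) w z.
  by move=> nQ; apply: many_hits_ge_half => //; exact: heavy.
apply: le_trans (ghost_sample_le (fun n z => (hits (E n) z)%:R <= M) w_ge0 likely) _.
rewrite -mulrA ler_pM2l// -(@ler_pM2l _ (2 ^+ #|I|)) ?exprn_gt0// sum_swaps.
have swaps_le u :
    #|[set s | [exists n in Q, skewed M (E n) (swap s u)]]|%:R * (w u.1 * w u.2) <=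
    2 ^+ #|I| * (G * expR (- (5 / 32 * M))) * (w u.1 * w u.2).
  have [->|w_neq0] := eqVneq (w u.1 * w u.2) 0; first by rewrite !mulr0.
  rewrite ler_wpM2r ?mulr_ge0//; apply: le_trans (card_skewed_swaps M0 E Q u) _.
  rewrite [leRHS]mulrC -[leRHS]mulrA ler_wpM2r ?mulr_ge0 ?expR_ge0 ?exprn_ge0//.
  move: w_neq0; rewrite mulf_eq0 negb_or => /andP[/prodf_neq0 u1 /prodf_neq0 u2].
  by apply: few_traces => i; [exact: u1|exact: u2].
apply: le_trans (ler_sum _ (fun u _ => swaps_le u)) _.
rewrite -mulr_sumr -(pair_big xpredT xpredT (fun z z' => w z * w z'))/=.
have sum_w : \sum_z w z = 1 by exact: sum_product_weight.
under eq_bigr => z _ do rewrite -mulr_sumr sum_w mulr1.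
by rewrite sum_w mulr1.
Qed.

(** * Sample size *)

Section SampleSize.
Variable K : realType.

Lemma growth_le_expR (t : K) (n D : nat) : 0 < t ->
  (1 + t) ^+ n / t ^+ D <= expR (n%:R * t - D%:R * ln t).
Proof.
move=> t0; rewrite expRD -mulrN !expRM_natl expRN lnK ?posrE// exprVn.
have t_ge0 := ltW t0; rewrite ler_wpM2r ?invr_ge0 ?exprn_ge0//.
by rewrite lerXn2r ?nnegrE ?expR_ge0 ?addr_ge0 ?expR_ge1Dx.
Qed.

Lemma ln2_ge_half : 1 / 2 <= ln (2 : K).
Proof.
have -> : (2 : K) = (1 + - (1 / 2))^-1.
  by rewrite (_ : 1 + - (1 / 2) = 2^-1) ?invrK//; lra.
by rewrite lnV ?posrE; [have := @le_ln1Dx K (- (1 / 2))|]; lra.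
Qed.

Lemma log_terms_le (d : nat) (l y x : K) :
  (1 <= d)%N -> ln 2 <= l -> 0 <= y -> 8 <= x ->
  1 <= d%:R * (l + y) * x /\
  ln 2 + d.+1%:R * (5 * ln 2 + l + ln x) + y <= 7 * (d%:R * (l + y) * x).
Proof.
move=> d1 l2 y0 x8; have dR : 1 <= d%:R :> K by rewrite (ler_nat _ 1).
have ln2 := ln2_ge_half; have lnx : ln x <= x by apply/ltW/ln_sublinear; lra.
have dly : l + y <= d%:R * (l + y) by rewrite ler_peMl//; lra.
have dlx : d%:R * l * x <= d%:R * (l + y) * x.
  by rewrite ler_wpM2r ?ler_wpM2l//; lra.
have lx : 5 * ln 2 + l + ln x <= 3 * (l * x) by nra.
have lx0 : 0 <= l * x by rewrite mulr_ge0//; lra.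
have dlx6 : (d%:R + 1) * (5 * ln 2 + l + ln x) <= 6 * (d%:R * l * x) by nra.
have ln2y : ln 2 + y <= d%:R * (l + y) * x by nra.
by split; [nra|rewrite -[d.+1]addn1 natrD; lra].
Qed.

Lemma small_error_bounds (q : nat) (e : K) : (2 <= q)%N -> 0 < e ->
  e < 1 / (4 * q%:R) -> 4 * e < 1 / 2 /\ 0 < e / (32 * q%:R) <= 1.
Proof.
move=> q2 e0 eq4; have qR : 2 <= q%:R :> K by rewrite (ler_nat _ 2).
have eq1 : e * (4 * q%:R) < 1 by rewrite -ltr_pdivlMr//; lra.
by split; [nra|rewrite divr_gt0 ?ler_pdivrMr//=; nra].
Qed.

Lemma opp_ln_div32 (e r : K) : 0 < e -> 0 < r ->
  - ln (e / (32 * r)) = 5 * ln 2 + ln r + ln (1 / e).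
Proof.
move=> e0 r0; have r32 : 0 < 32 * r by rewrite mulr_gt0.
rewrite -lnV ?posrE ?divr_gt0// invf_div.
rewrite (_ : 32 * r / e = 2 ^+ 5 * r * (1 / e)); last by rewrite mul1r -natrX.
rewrite lnM ?posrE ?divr_gt0 ?mulr_gt0 ?exprn_gt0// lnM ?posrE ?exprn_gt0// lnXn//.
by rewrite [5 * _]mulr_natl.
Qed.

Lemma sample_size_suffices (d q m : nat) (e delta : K) (t := e / (32 * q%:R)) :
  (1 <= d)%N -> (2 <= q)%N -> 0 < e -> e < 1 / (4 * q%:R) -> 0 < delta <= 1 ->
  100 * d%:R * (ln q%:R + ln (1 / delta)) / e ^+ 2 <= m%:R ->
  3 <= e * m%:R /\
  2 * ((1 + t) ^+ (2 * (m * q)) / t ^+ d.+1) * expR (- (5 / 32 * (e * m%:R))) <=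
  delta.
Proof.
move=> d1 q2 e0 eq4 /andP[de0 de1] m_ge.
have qR : 2 <= q%:R :> K by rewrite (ler_nat _ 2).
have t0 : 0 < t by rewrite divr_gt0//; lra.
pose x := 1 / e; have x0 : 0 < x by rewrite divr_gt0.
have x8 : 8 <= x.
  rewrite ler_pdivlMr// -ler_pdivlMl// mulr1; apply: ltW; apply: lt_le_trans eq4 _.
  by rewrite mul1r lef_pV2 ?posrE; lra.
set l := ln q%:R in m_ge; pose y := ln (1 / delta); rewrite -/y in m_ge.
have l2 : ln 2 <= l by rewrite ler_ln ?posrE//; lra.
have y0 : 0 <= y by rewrite ln_ge0// ler_pdivlMr// mul1r.
have [big_enough logs] := log_terms_le d1 l2 y0 x8.
have em : 100 * (d%:R * (l + y) * x) <= e * m%:R.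
  rewrite (_ : 100 * _ = e * (100 * d%:R * (l + y) / e ^+ 2)) ?ler_pM2l//.
  by rewrite /x; field; rewrite gt_eqF.
split; first by lra.
have lnt : - ln t = 5 * ln 2 + l + ln x by apply: opp_ln_div32 => //; lra.
have nt : (2 * (m * q))%:R * t = e * m%:R / 16.
  by rewrite !natrM /t; field; rewrite gt_eqF//; lra.
have two : 2 = expR (ln 2) :> K by rewrite lnK ?posrE.
have deltaE : delta = expR (- y).
  by rewrite /y expRN div1r lnV ?posrE// expRN lnK ?posrE// invrK.
apply: (@le_trans _ _ (expR (ln 2) *
    expR ((2 * (m * q))%:R * t - d.+1%:R * ln t) * expR (- (5 / 32 * (e * m%:R))))).
  by rewrite -two ler_wpM2r ?expR_ge0// ler_pM2l// growth_le_expR.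
by rewrite [leRHS]deltaE -!expRD ler_expR nt -mulrN lnt; lra.
Qed.
End SampleSize.

Local Open Scope classical_set_scope.

(** * Real-valued probabilities *)

Section MeasurableBool.
Context {dT : measure_display} {T : measurableType dT}.
Implicit Types f g : T -> bool.

Lemma measurable_fun_fiber f (b : bool) :
  measurable_fun setT f -> measurable [set x | f x = b].
Proof.
by move=> mf; rewrite -[X in measurable X]setTI; exact: (mf measurableT [set b]).
Qed.

Lemma measurable_fun_true f : measurable_fun setT f -> measurable [set x | f x].
Proof. exact: (@measurable_fun_fiber f true). Qed.

Lemma measurable_set_eqb f g : measurable_fun setT f -> measurable_fun setT g ->
  measurable [set x | f x == g x].
Proof.
move=> mf mg; rewrite (_ : [set x | _] =
    [set x | (f x && g x) || (~~ f x && ~~ g x)]); last first.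
  by apply/seteqP; split=> x /=; case: (f x); case: (g x).
apply: (measurable_fun_true (f := fun x => (f x && g x) || (~~ f x && ~~ g x))).
by apply: measurable_or; apply: measurable_and => //; exact: measurable_neg.
Qed.

Lemma measurable_set_neqb f g : measurable_fun setT f -> measurable_fun setT g ->
  measurable [set x | f x != g x].
Proof.
move=> mf mg; rewrite (_ : [set x | _] = [set x | f x == ~~ g x]); last first.
  by apply/seteqP; split=> x /=; case: (f x); case: (g x).
by apply: measurable_set_eqb => //; exact: measurable_neg.
Qed.

Lemma measurable_fibers (I : finType) (g : T -> I) (Q : pred I) :
  (forall i, measurable [set x | g x = i]) -> measurable [set x | Q (g x)].
Proof.
move=> mg; rewrite (_ : [set x | _] = \bigcup_(i in [set` Q]) [set x | g x = i]).
  by apply: fin_bigcup_measurable => [|i _]; [exact: finite_finset|exact: mg].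
by apply/seteqP; split=> [x Qx|x [i Qi /= ->]//]; exists (g x).
Qed.
End MeasurableBool.

Section RealProbability.
Context {dT : measure_display} {T : measurableType dT} {K : realType}.
Variable P : probability T K.

Definition pr (A : set T) : K := fine (P A).

Lemma EFin_pr A : measurable A -> (pr A)%:E = P A.
Proof. by move=> mA; rewrite fineK// fin_num_measure. Qed.

Lemma pr_ge0 A : 0 <= pr A.
Proof. exact: fine_ge0. Qed.

Lemma pr_setT : pr setT = 1.
Proof. by rewrite /pr probability_setT. Qed.

Lemma pr_set0 : pr set0 = 0.
Proof. by rewrite /pr measure0. Qed.

Lemma pr_setC A : measurable A -> pr (~` A) = 1 - pr A.
Proof.
move=> mA; apply: EFin_inj; rewrite EFinB !EFin_pr ?probability_setC//.
exact: measurableC.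
Qed.

Lemma le_pr A B : measurable A -> measurable B -> A `<=` B -> pr A <= pr B.
Proof. by move=> mA mB AB; rewrite -lee_fin !EFin_pr// le_measure ?inE. Qed.

Lemma pr_le1 A : measurable A -> pr A <= 1.
Proof. by move=> mA; rewrite -pr_setT le_pr. Qed.

Lemma le_pr_setU A B C : measurable A -> measurable B -> measurable C ->
  A `<=` B `|` C -> pr A <= pr B + pr C.
Proof.
move=> mA mB mC ABC; rewrite -lee_fin EFinD !EFin_pr//.
apply: le_trans (measureU2 _ mB mC); apply: le_measure; rewrite ?inE//.
exact: measurableU.
Qed.

Lemma pr_set_neg (h : T -> bool) : measurable_fun setT h ->
  pr [set x | ~~ h x] = 1 - pr [set x | h x].
Proof.
move=> mh; rewrite -pr_setC; last exact: measurable_fun_true.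
by congr pr; apply/seteqP; split=> x /= /negP.
Qed.

Lemma pr_fibers (I : finType) (g : T -> I) (Q : pred I) (A : set T) :
  (forall i, measurable [set x | g x = i]) -> measurable A ->
  pr ([set x | Q (g x)] `&` A) = \sum_(i | Q i) pr ([set x | g x = i] `&` A).
Proof.
move=> mg mA; have mgA i : measurable ([set x | g x = i] `&` A).
  by apply: measurableI.
apply: EFin_inj; rewrite EFin_pr; last first.
  by apply: measurableI => //; exact: measurable_fibers.
rewrite -sumEFin (eq_bigr (fun i => P ([set x | g x = i] `&` A))); last first.
  by move=> i _; rewrite EFin_pr.
rewrite (_ : _ `&` A = \bigcup_(i in [set` Q]) ([set x | g x = i] `&` A)); last first.
  by apply/seteqP; split=> [x [Qx Ax]|x [i Qi [/= -> Ax]]//]; exists (g x).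
rewrite measure_fin_bigcup//.
  apply/esym/bigfs; first exact: index_enum_uniq.
  by move=> i _; rewrite mem_index_enum.
by apply/trivIsetP => i j _ _ /eqP ij; apply/seteqP; split=> x //= [[-> _] []].
Qed.

Lemma pr_bigcup_le (B : nat -> set T) (delta : K) :
  (forall n, measurable (B n)) -> nondecreasing_seq B ->
  (forall n, pr (B n) <= delta) -> pr (\bigcup_n B n) <= delta.
Proof.
move=> mB incB leB; have mU : measurable (\bigcup_n B n) by exact: bigcup_measurable.
rewrite -lee_fin EFin_pr//; have cvgB := nondecreasing_cvg_mu (mu := P) mB mU incB.
by apply: cvge_le cvgB; apply: nearW => n /=; rewrite -EFin_pr ?lee_fin.
Qed.

Lemma pr_neq_cvg0 (h_ : nat -> T -> bool) (h : T -> bool) :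
  (forall n, measurable_fun setT (h_ n)) -> measurable_fun setT h ->
  (forall x, \forall n \near \oo, h_ n x = h x) ->
  pr [set x | h_ n x != h x] @[n --> \oo] --> 0.
Proof.
move=> mh_ mh cvgh; pose F n := [set x | h_ n x != h x].
have mF n : measurable (F n) by exact: measurable_set_neqb.
pose tail n := \bigcup_(k in [set k | (n <= k)%N]) F k.
have mtail n : measurable (tail n) by apply: bigcup_measurable.
have : P (tail n) @[n --> \oo] --> 0%E.
  have -> : 0%E = P (lim_sup_set F).
    rewrite (_ : lim_sup_set F = set0) ?measure0//; apply/seteqP; split=> x // Fx.
    have [N _ hN] := cvgh x; have [k /= Nk] := Fx N Logic.I.
    by rewrite /F /= hN ?eqxx.
  apply: lim_sup_set_cvg => //; rewrite -ge0_fin_numE// fin_num_measure//.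
  exact: (mtail 0%N).
move=> /fine_cvgP[_]; apply: squeeze_cvgr; last exact: cvg_cst.
apply: nearW => n; rewrite pr_ge0 le_pr//; first exact: mF.
by move=> x Fx; exists n => /=.
Qed.

Lemma pr_neq_gt_near (g h : T -> bool) (h_ : nat -> T -> bool) (eta : K) :
  measurable_fun setT g -> (forall n, measurable_fun setT (h_ n)) ->
  measurable_fun setT h -> (forall x, \forall n \near \oo, h_ n x = h x) ->
  eta < pr [set x | g x != h x] ->
  \forall n \near \oo, eta < pr [set x | g x != h_ n x].
Proof.
move=> mg mh_ mh cvgh eta_lt; have := pr_neq_cvg0 mh_ mh cvgh.
move=> /cvgrPdist_lt/(_ (pr [set x | g x != h x] - eta)).
rewrite subr_gt0 => /(_ eta_lt).
apply: filterS => n; rewrite sub0r normrN ger0_norm ?pr_ge0// => close.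
suff : pr [set x | g x != h x] <=
    pr [set x | g x != h_ n x] + pr [set x | h_ n x != h x] by lra.
apply: le_pr_setU; try exact: measurable_set_neqb.
by move=> x /=; have [->|] := eqVneq (h_ n x) (h x); [left|right].
Qed.

Definition conditioned (S : set T) (mS : measurable S) : probability T K :=
  mnormalize (mrestr P mS) P.
End RealProbability.

Lemma pr_conditioned dT (T : measurableType dT) (K : realType) (P : probability T K)
    (S : set T) (mS : measurable S) (A : set T) :
  measurable A -> 0 < pr P S -> pr (conditioned P mS) A = pr P (A `&` S) / pr P S.
Proof.
move=> mA S0; have mAS : measurable (A `&` S) by apply: measurableI.
rewrite {1}/pr /conditioned/= /mnormalize /= /mrestr setTI -(EFin_pr P mS).
by rewrite eqe gt_eqF//= -(EFin_pr P mAS).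
Qed.

(** * Recovering a classifier from the accuracy of its bags *)

(* The coefficient is the probability that exactly [k] points of a bag get label 1. *)
Definition bag_error dT (T : measurableType dT) (K : realType) (B : finType)
    (law : B -> probability T K) (k : nat) (h : T -> bool) : K :=
  1 - (\prod_j bernoulli_poly (pr (law j) [set x | h x]))`_k.

Section Recovery.
Context {dT : measure_display} {T : measurableType dT} {K : realType}.
Variables (D : probability T K) (f : T -> bool) (mf : measurable_fun setT f).
Implicit Types (h : T -> bool) (b : bool) (eta : K).

Definition class_conditioned b : probability T K :=
  conditioned D (measurable_fun_fiber b mf).

(* [balanced] says whether a bag contains as many positive as negative points. *)
Definition recovers eta (balanced : bool) h : Prop :=
  pr D [set x | f x != h x] <= eta \/ (balanced /\ pr D [set x | f x == h x] <= eta).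

Lemma unrecovered_near (h_ : nat -> T -> bool) h eta balanced :
  (forall n, measurable_fun setT (h_ n)) -> measurable_fun setT h ->
  (forall x, \forall n \near \oo, h_ n x = h x) ->
  ~ recovers eta balanced h -> \forall n \near \oo, ~ recovers eta balanced (h_ n).
Proof.
move=> mh_ mh cvgh not_rec; have mnf := measurable_neg mf.
have eqE g : [set x | f x == g x] = [set x | ~~ f x != g x].
  by apply/seteqP; split=> x /=; case: (f x); case: (g x).
have neq_near : \forall n \near \oo, eta < pr D [set x | f x != h_ n x].
  apply: pr_neq_gt_near cvgh _ => //.
  by rewrite ltNge; apply/negP => f_h; apply: not_rec; left.
case: balanced not_rec => not_rec; last first.
  by near=> n; case=> [|[]//]; apply/negP; rewrite -ltNge; near: n.
have eq_near : \forall n \near \oo, eta < pr D [set x | ~~ f x != h_ n x].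
  apply: pr_neq_gt_near cvgh _ => //.
  by rewrite -eqE ltNge; apply/negP => f_h; apply: not_rec; right.
by near=> n; case=> [|[_]]; rewrite ?eqE; apply/negP; rewrite -ltNge; near: n.
Unshelve. all: by end_near. Qed.

Hypothesis class_gt0 : forall b, 0 < pr D [set x | f x = b].

Lemma pr_le_class A eta : measurable A ->
  (forall b, pr (class_conditioned b) A <= eta) -> pr D A <= eta.
Proof.
move=> mA A_le.
have total B : measurable B -> pr D B = \sum_b pr D ([set x | f x = b] `&` B).
  move=> mB; rewrite -(pr_fibers D predT (fun b => measurable_fun_fiber b mf) mB).
  by rewrite (_ : [set x | _] = setT) ?setTI//; apply/seteqP.
rewrite -[leRHS]mulr1 -(pr_setT D) (total _ mA) (total _ measurableT) mulr_sumr.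
apply: ler_sum => b _; rewrite setIT setIC -ler_pdivrMr//.
by rewrite -(pr_conditioned (measurable_fun_fiber b mf))//; exact: A_le.
Qed.

Lemma pr_class_congr b A B : measurable A -> measurable B ->
  (forall x, f x = b -> A x <-> B x) ->
  pr (class_conditioned b) A = pr (class_conditioned b) B.
Proof.
move=> mA mB AB; rewrite !pr_conditioned//; congr (pr D _ / _).
by apply/seteqP; split=> x [Bx fx]; split=> //; apply/(AB x fx).
Qed.

Lemma pr_neq_le h eta : measurable_fun setT h ->
  1 - pr (class_conditioned true) [set x | h x] <= eta ->
  pr (class_conditioned false) [set x | h x] <= eta ->
  pr D [set x | f x != h x] <= eta.
Proof.
move=> mh h1 h0; have mnh := measurable_neg mh.
apply: pr_le_class => [|b]; first exact: measurable_set_neqb.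
rewrite (@pr_class_congr b _ [set x | if b then ~~ h x else h x]).
- by case: b; rewrite ?pr_set_neg.
- exact: measurable_set_neqb.
- by case: b; exact: measurable_fun_true.
- by move=> x /= ->; case: b => /=; case: (h x); split.
Qed.

Lemma recovers_of_bag_error (B : finType) (A : {set B}) h eta :
  measurable_fun setT h -> (0 < #|A| < #|B|)%N -> eta < 1 / 2 ->
  bag_error (fun j => class_conditioned (j \in A)) #|A| h <= eta ->
  recovers eta (#|A|.*2 == #|B|) h.
Proof.
move=> mh A_proper eta2; rewrite /bag_error lerBlDr -lerBlDl => accurate.
have mnh := measurable_neg mh.
have s01 b : 0 <= pr (class_conditioned b) [set x | h x] <= 1.
  by rewrite pr_ge0 pr_le1//; exact: measurable_fun_true.
case: (bernoulli_prod_concentration A_proper s01 eta2 accurate)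
    => [[h1 h0]|[eqA h1 h0]]; first by left; exact: pr_neq_le.
right; rewrite eqA eqxx; split=> //.
rewrite (_ : [set x | _] = [set x | f x != ~~ h x]); last first.
  by apply/seteqP; split=> x /=; case: (f x); case: (h x).
by apply: pr_neq_le; rewrite // pr_set_neg// subKr.
Qed.
End Recovery.

(** * Bags drawn independently *)

Definition bag_misses (T : Type) (I B : finType) (k : nat) (h : T -> bool)
    (bags : I -> B -> T) : nat :=
  (\sum_i ((\sum_j h (bags i j))%N != k))%N.

Section BagSample.
Context {dT : measure_display} {T : measurableType dT} {K : realType}.
Context {dO : measure_display} {O : measurableType dO}.
Variables (I B : finType) (P : probability O K) (X : I -> B -> O -> T).
Variables (law : B -> probability T K) (k : nat) (M : K).

Definition product_law : Prop :=
  forall A : I -> B -> set T, (forall i j, measurable (A i j)) ->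
  pr P [set w | forall i j, A i j (X i j w)] = \prod_i \prod_j pr (law j) (A i j).

Definition misled (J : Type) (h : J -> T -> bool) (Q : pred J) : set O :=
  [set w | exists2 n, Q n & (bag_misses k (h n) (fun i j => X i j w))%:R <= M].

Hypothesis mX : forall i j, measurable_fun setT (X i j).
Hypothesis X_law : product_law.

Section FiniteClass.
Variables (J : finType) (h : J -> T -> bool) (Q : pred J).
Hypothesis mh : forall n, measurable_fun setT (h n).

Local Notation pattern := {ffun J -> bool}.

Definition pattern_of (x : T) : pattern := [ffun n => h n x].

Lemma measurable_pattern t : measurable [set x | pattern_of x = t].
Proof.
rewrite (_ : [set x | _] = \bigcap_(n in [set: J]) [set x | h n x = t n]).
  apply: fin_bigcap_measurable; first exact: finite_finset.
  by move=> n _; exact: measurable_fun_fiber.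
apply/seteqP; split=> x /=; first by move=> <- n _ /=; rewrite ffunE.
by move=> ht; apply/ffunP => n; rewrite ffunE; exact: ht.
Qed.

Definition pattern_weight (j : B) (t : pattern) : K :=
  pr (law j) [set x | pattern_of x = t].

Lemma sum_pattern_weight (A : pred pattern) j :
  \sum_(t | A t) pattern_weight j t = pr (law j) [set x | A (pattern_of x)].
Proof.
rewrite -[in RHS](setIT [set x | _]) (pr_fibers _ _ measurable_pattern)//.
by apply: eq_bigr => t _; rewrite setIT.
Qed.

Lemma sum_pattern_weightT j : \sum_t pattern_weight j t = 1.
Proof.
by rewrite sum_pattern_weight -(pr_setT (law j)); congr pr; apply/seteqP.
Qed.

Lemma pattern_weight_neq0 j t : pattern_weight j t != 0 -> exists x, pattern_of x = t.
Proof.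
move=> t_neq0; apply: contrapT => none; move: t_neq0; rewrite /pattern_weight.
rewrite (_ : [set x | _] = set0) ?pr_set0 ?eqxx//.
by apply/seteqP; split=> x //= xt; apply: none; exists x.
Qed.

Definition bag_weight : {ffun B -> pattern} -> K := product_weight pattern_weight.

Definition bag_missed (n : J) (z : {ffun B -> pattern}) : bool :=
  (\sum_j z j n)%N != k.

Lemma sum_bag_missed n : \sum_(z | bag_missed n z) bag_weight z =
  bag_error law k (h n).
Proof.
rewrite /bag_error -(sum_product_weight sum_pattern_weightT).
rewrite [in RHS](bigID (bag_missed n))/=.
rewrite (eq_bigr (fun j => bernoulli_poly
  (\sum_(t : pattern | t n) pattern_weight j t))) => [|j _]; last first.
  rewrite sum_pattern_weight; congr (bernoulli_poly (pr _ _)).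
  by apply/seteqP; split=> x /=; rewrite ffunE.
rewrite (coef_bernoulli_prod (fun t : pattern => t n) k sum_pattern_weightT).
rewrite [X in _ - X](eq_bigl (fun z => ~~ bag_missed n z)) ?addrK// => z.
by rewrite /bag_missed negbK.
Qed.

Definition sample_pattern (w : O) : {ffun I -> {ffun B -> pattern}} :=
  [ffun i => [ffun j => pattern_of (X i j w)]].

Lemma sample_pattern_fiber z : [set w | sample_pattern w = z] =
  [set w | forall i j, [set x | pattern_of x = z i j] (X i j w)].
Proof.
apply/seteqP; split=> w /=; first by move=> <- i j; rewrite !ffunE.
by move=> wz; apply/ffunP => i; apply/ffunP => j; rewrite !ffunE; exact: wz.
Qed.

Lemma measurable_sample_pattern z : measurable [set w | sample_pattern w = z].
Proof.
rewrite sample_pattern_fiber (_ : [set w | _] = \bigcap_(p in [set: I * B])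
    (X p.1 p.2 @^-1` [set x | pattern_of x = z p.1 p.2])); last first.
  by apply/seteqP; split=> w /= wz => [[i j] _|i j]; [exact: wz|exact: (wz (i, j))].
apply: fin_bigcap_measurable; first exact: finite_finset.
move=> p _; rewrite -[X in measurable X]setTI; apply: mX => //.
exact: measurable_pattern.
Qed.

Lemma pr_sample_pattern z :
  pr P [set w | sample_pattern w = z] = product_weight (fun=> bag_weight) z.
Proof.
rewrite sample_pattern_fiber.
rewrite (X_law (A := fun i j => [set x | pattern_of x = z i j]))//.
by move=> i j; exact: measurable_pattern.
Qed.

Definition misleading (z : {ffun I -> {ffun B -> pattern}}) : bool :=
  [exists n in finset Q, (hits (bag_missed n) z)%:R <= M].

Lemma misledE : misled h Q = [set w | misleading (sample_pattern w)].
Proof.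
have missE n w : hits (bag_missed n) (sample_pattern w) =
    bag_misses k (h n) (fun i j => X i j w).
  apply: eq_bigr => i _; rewrite /bag_missed ffunE; congr (nat_of_bool (_ != _)).
  by apply: eq_bigr => j _; rewrite !ffunE.
apply/seteqP; split=> w /= => [[n Qn few]|/exists_inP[n Qn few]].
  by apply/exists_inP; exists n; rewrite ?inE ?missE.
by exists n; [move: Qn; rewrite inE|rewrite -missE].
Qed.

Lemma measurable_misled_finite : measurable (misled h Q).
Proof.
by rewrite misledE; exact: (measurable_fibers misleading measurable_sample_pattern).
Qed.

Lemma card_bag_traces (S : {set J}) (G : K)
    (u : double_sample I {ffun B -> pattern}) :
  (forall y : bool * (I * B) -> T, #|restrictions h S y|%:R <= G) ->
  (forall i, bag_weight (u.1 i) != 0) -> (forall i, bag_weight (u.2 i) != 0) ->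
  #|[set trace (bag_missed n) u | n in S]%SET|%:R <= G.
Proof.
move=> growth u1 u2.
pose pattern_at (p : bool * (I * B)) : pattern :=
  if p.1 then u.2 p.2.1 p.2.2 else u.1 p.2.1 p.2.2.
have realized p : exists x, pattern_of x = pattern_at p.
  apply: (@pattern_weight_neq0 p.2.2); case: p => [[] [i j]]; rewrite /pattern_at /=.
    by have /prodf_neq0 := u2 i; apply.
  by have /prodf_neq0 := u1 i; apply.
have [y patternE] := choice realized; apply: le_trans (growth y); rewrite ler_nat.
pose missed_of (l : {ffun bool * (I * B) -> bool}) side : {ffun I -> bool} :=
  [ffun i => (\sum_j l (side, (i, j)))%N != k].
rewrite (_ : [set trace _ u | n in _]%SET =
    (fun l => (missed_of l false, missed_of l true)) @: restrictions h S y)%SET.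
  exact: leq_imset_card.
rewrite -imset_comp; apply: eq_imset => n /=.
congr pair; apply/ffunP => i; rewrite !ffunE /bag_missed; congr (~~ (_ == _));
  apply: eq_bigr => j _; rewrite ffunE.
  by rewrite -[u.1 i j]/(pattern_at (false, (i, j))) -patternE ffunE.
by rewrite -[u.2 i j]/(pattern_at (true, (i, j))) -patternE ffunE.
Qed.

Lemma pr_misled_finite_le (G : K) : 3 <= M ->
  (forall n, Q n -> 4 * M <= #|I|%:R * bag_error law k (h n)) ->
  (forall y : bool * (I * B) -> T, #|restrictions h (finset Q) y|%:R <= G) ->
  pr P (misled h Q) <= 2 * G * expR (- (5 / 32 * M)).
Proof.
move=> M3 heavy growth; rewrite misledE -(setIT [set w | _]).
rewrite (pr_fibers P misleading measurable_sample_pattern)//.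
rewrite (eq_bigr (product_weight (fun=> bag_weight))) => [|z _]; last first.
  by rewrite setIT pr_sample_pattern.
apply: uniform_hits_bound => //.
- by move=> z; apply: product_weight_ge0 => j t; exact: pr_ge0.
- exact: sum_product_weight sum_pattern_weightT.
- by move=> n; rewrite inE sum_bag_missed; exact: heavy.
- by move=> u; exact: card_bag_traces.
Qed.
End FiniteClass.

Section CountableClass.
Variables (h : nat -> T -> bool) (Q : pred nat).
Hypothesis mh : forall n, measurable_fun setT (h n).

Definition misled_upto N : set O := misled (fun n : 'I_N => h n) (fun n => Q n).

Lemma misled_bigcup : misled h Q = \bigcup_N misled_upto N.
Proof.
apply/seteqP; split=> w => [[n Qn few]|[N _ [n Qn few]]]; last by exists n.
by exists n.+1 => //; exists ord_max.
Qed.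

Lemma measurable_misled_upto N : measurable (misled_upto N).
Proof. exact: measurable_misled_finite. Qed.

Lemma measurable_misled : measurable (misled h Q).
Proof.
by rewrite misled_bigcup; apply: bigcup_measurable => N _;
  exact: measurable_misled_upto.
Qed.

Lemma pr_misled_le (G : K) : 3 <= M ->
  (forall n, Q n -> 4 * M <= #|I|%:R * bag_error law k (h n)) ->
  (forall N (S : {set 'I_N}) (y : bool * (I * B) -> T),
     #|restrictions (fun n : 'I_N => h n) S y|%:R <= G) ->
  pr P (misled h Q) <= 2 * G * expR (- (5 / 32 * M)).
Proof.
move=> M3 heavy growth; rewrite misled_bigcup; apply: pr_bigcup_le.
- exact: measurable_misled_upto.
- move=> N N' NN'; apply/subsetPset => w [n Qn few].
  by exists (widen_ord NN' n).
- by move=> N; apply: pr_misled_finite_le => // n; exact: heavy.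
Qed.
End CountableClass.
End BagSample.

Section BagLearning.
Context {dT : measure_display} {T : measurableType dT} {K : realType}.
Context {dO : measure_display} {O : measurableType dO}.
Variables (I B : finType) (P : probability O K) (X : I -> B -> O -> T).
Variables (D : probability T K) (f : T -> bool) (mf : measurable_fun setT f).
Variables (A : {set B}) (h : nat -> T -> bool) (M eta : K).
Hypothesis class_gt0 : forall b, 0 < pr D [set x | f x = b].
Hypothesis A_proper : (0 < #|A| < #|B|)%N.
Hypothesis mX : forall i j, measurable_fun setT (X i j).
Hypothesis X_law : product_law P X (fun j => class_conditioned D mf (j \in A)).
Hypothesis mh : forall n, measurable_fun setT (h n).

Local Notation recovered := (recovers D f eta (#|A|.*2 == #|B|)).

Definition unrecovered (n : nat) : bool := `[< ~ recovered (h n) >].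

Definition fooled : set O := misled X #|A| M h unrecovered.

Lemma measurable_fooled : measurable fooled.
Proof. exact: measurable_misled. Qed.

Lemma pr_fooled_le (G : K) : 3 <= M -> 4 * M <= #|I|%:R * eta -> eta < 1 / 2 ->
  (forall N (S : {set 'I_N}) (y : bool * (I * B) -> T),
     #|restrictions (fun n : 'I_N => h n) S y|%:R <= G) ->
  pr P fooled <= 2 * G * expR (- (5 / 32 * M)).
Proof.
move=> M3 M4 eta2 growth; apply: (pr_misled_le mX X_law mh M3 _ growth) => n.
move=> /asboolP not_rec; apply: le_trans M4 _; rewrite ler_wpM2l// leNgt.
by apply/negP => /ltW err; exact/not_rec/recovers_of_bag_error.
Qed.

Lemma recovers_of_not_fooled (w : O) (g : T -> bool) (s : nat -> nat) :
  ~ fooled w -> measurable_fun setT g ->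
  (forall x, \forall n \near \oo, h (s n) x = g x) ->
  (bag_misses #|A| g (fun i j => X i j w))%:R <= M -> recovered g.
Proof.
move=> not_fooled mg cvgh few; apply: contrapT => not_rec.
have unrec := unrecovered_near mf (fun n => mh (s n)) mg cvgh not_rec.
have agree : \forall n \near \oo, forall p : I * B,
    h (s n) (X p.1 p.2 w) = g (X p.1 p.2 w) by apply: filter_forall => p; exact: cvgh.
have [n [unrec_n agree_n]] := filter_ex (filterI unrec agree).
apply: not_fooled; exists (s n); first exact/asboolP.
rewrite (_ : bag_misses _ _ _ = bag_misses #|A| g (fun i j => X i j w))//.
apply: eq_bigr => i _; congr (nat_of_bool (_ != _)); apply: eq_bigr => j _.
by rewrite (agree_n (i, j)).
Qed.
End BagLearning.

(** * Halfspaces *)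

Section Halfspaces.
Variables (K : realType) (d : nat).
Implicit Types (w : 'rV[K]_d * K) (x : 'rV[K]_d).

Definition score w x : K := \sum_(i < d) w.1 ord0 i * x ord0 i + w.2.

Definition label w x : bool := 0 < score w x.

Lemma label_positive_on w x :
  label w x = positive_on (row_mx w.1 w.2%:M) (col_mx x^T 1%:M).
Proof.
rewrite /label /positive_on mul_row_col mulmx1 !mxE eqxx mulr1n; congr (_ < _ + _).
by apply: eq_bigr => i _; rewrite !mxE.
Qed.

Lemma card_label_le (t : K) (V J : finType) (y : V -> 'rV[K]_d)
    (w : J -> 'rV[K]_d * K) (Q : {set J}) :
  0 < t <= 1 ->
  #|restrictions (fun n => label (w n)) Q y|%:R <= (1 + t) ^+ #|V| / t ^+ d.+1.
Proof.
move=> t01; rewrite (_ : restrictions _ _ _ = restrictions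
    (fun n => positive_on (row_mx (w n).1 (w n).2%:M)) Q
    (fun p => col_mx (y p)^T 1%:M)); last first.
  by apply: eq_imset => n; apply/ffunP => p; rewrite !ffunE label_positive_on.
by rewrite -[d.+1]addn1 card_positive_on_le.
Qed.

Lemma open_label w : open [set x | label w x].
Proof.
pose linear_part x : K := \sum_(i < d) w.1 ord0 i * x ord0 i.
have linear_continuous : continuous linear_part.
  apply: continuous_big => [|i _ y]; first exact: add_continuous.
  apply: (@continuousM K 'rV[K]_d (fun=> _) (fun y : 'rV[K]_d => y ord0 i)).
    exact: cst_continuous.
  exact: coord_continuous.
rewrite (_ : [set x | _] = linear_part @^-1` [set y | - w.2 < y]); last first.
  by apply/seteqP; split=> x; rewrite /= /label /score -ltrBlDr sub0r.
by apply: open_comp => [x _|]; [exact: linear_continuous|exact: open_gt].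
Qed.

Lemma label_perturb w w' x (e : K) : 0 < e ->
  (forall i, `|w'.1 ord0 i - w.1 ord0 i| <= e ^+ 2) ->
  w.2 - 2 * e <= w'.2 <= w.2 - e -> e * \sum_(i < d) `|x ord0 i| <= 1 ->
  (0 < score w x -> 4 * e <= score w x) -> label w' x = label w x.
Proof.
move=> e0 normal_near /andP[c_ge c_le] small gap; rewrite /label.
have : `|score w' x - w'.2 - (score w x - w.2)| <= e.
  rewrite /score !addrK -sumrB; apply: le_trans (ler_norm_sum _ _ _) _.
  apply: (@le_trans _ _ (\sum_(i < d) e ^+ 2 * `|x ord0 i|)).
    by apply: ler_sum => i _; rewrite -mulrBl normrM ler_wpM2r.
  by rewrite -mulr_sumr expr2 -mulrA ler_piMr// ltW.
rewrite ler_norml => /andP[diff_ge diff_le].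
have [/gap|score_le0] := ltP 0 (score w x); first by move=> gap4; apply/idP; lra.
by apply/negbTE; rewrite -leNgt; lra.
Qed.

Definition rational_halfspace (n : nat) : 'rV[K]_d * K :=
  if unpickle n is Some (r, c) then (map_mx ratr (r : 'rV[rat]_d), ratr (c : rat))
  else (0, 0).

(* Lowering the threshold by about [e] while moving the normal by [e^2] keeps the
   points of the boundary hyperplane on the nonpositive side. *)
Lemma rational_halfspace_near w (e : K) : 0 < e -> exists n,
  (forall i, `|(rational_halfspace n).1 ord0 i - w.1 ord0 i| <= e ^+ 2) /\
  w.2 - 2 * e <= (rational_halfspace n).2 <= w.2 - e.
Proof.
move=> e0; have e20 : 0 < e ^+ 2 by rewrite exprn_gt0.
have rat_between (y z : K) : y < z -> exists p : rat, y < ratr p < z.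
  by move=> /rat_in_itvoo[p]; rewrite in_itv /=; exists p.
have /choice[p p_near] : forall i, exists q : rat, `|ratr q - w.1 ord0 i| <= e ^+ 2.
  move=> i; pose r := w.1 ord0 i.
  have [|q q_near] := rat_between (r - e ^+ 2) (r + e ^+ 2); first by lra.
  by exists q; rewrite ler_norml -/r; lra.
have [|c c_near] := rat_between (w.2 - 2 * e) (w.2 - e); first by lra.
exists (pickle (\row_i p i : 'rV[rat]_d, c)); rewrite /rational_halfspace pickleK.
by split=> [i|/=]; [rewrite !mxE|lra].
Qed.

Lemma rational_label_cvg w : exists s : nat -> nat, forall x,
  \forall n \near \oo, label (rational_halfspace (s n)) x = label w x.
Proof.
have e_gt0 n : 0 < n.+1%:R^-1 :> K by rewrite invr_gt0.
have [s s_near] := choice (fun n => rational_halfspace_near w (e_gt0 n)).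
exists s => x; set S := \sum_(i < d) `|x ord0 i|.
have S0 : 0 <= S by apply: sumr_ge0.
have S1 : 0 < 1 / (S + 1) by rewrite divr_gt0//; lra.
pose gap := if 0 < score w x then score w x / 4 else 1.
have gap0 : 0 < gap by rewrite /gap; case: ifP => // ?; rewrite divr_gt0.
near=> n; have [normal_near threshold_near] := s_near n.
apply: (label_perturb (e_gt0 n)) => //.
  have : n.+1%:R^-1 * (S + 1) <= 1.
    rewrite -ler_pdivlMr; last lra.
    by apply: ltW; near: n; exact: (near_infty_natSinv_lt (PosNum S1)).
  by apply: le_trans; rewrite mulrDr mulr1 lerDl ltW.
move=> score0; rewrite mulrC -ler_pdivlMr//.
have -> : score w x / 4 = gap by rewrite /gap score0.
by apply: ltW; near: n; exact: (near_infty_natSinv_lt (PosNum gap0)).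
Unshelve. all: by end_near. Qed.
End Halfspaces.

(** * Bags of points of [Rd d] *)

Lemma measurable_label (d : nat) (w : 'rV[R]_d * R) :
  measurable_fun setT (label w : Rd d -> bool).
Proof.
apply: (measurable_fun_bool true); rewrite setTI.
by apply: sub_sigma_algebra; exact: open_label.
Qed.

Lemma bool_natr_inj (K : numDomainType) : injective (fun b : bool => b%:R : K).
Proof. by move=> [] [] //= /eqP; rewrite ?oner_eq0// eq_sym oner_eq0. Qed.

Section Ltf.
Variables (d : nat) (D : probability (Rd d) R) (r0 : 'rV[R]_d) (c0 : R).
Implicit Types (r : 'rV[R]_d) (c : R).

Lemma ltfE r c (x : Rd d) : ltf r c x = (label (r, c) x)%:R.
Proof. by rewrite /ltf /pos -/(score (r, c) x) -/(label (r, c) x); case: label. Qed.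

Lemma ltf_fiber (b : bool) :
  [set x : Rd d | ltf r0 c0 x = b%:R] = [set x : Rd d | label (r0, c0) x = b].
Proof.
by apply/seteqP; split=> x /=; rewrite ltfE; [exact: bool_natr_inj|move->].
Qed.

Lemma disagreeE r c : disagree D (ltf r0 c0) (ltf r c) =
  pr D [set x : Rd d | label (r0, c0) x != label (r, c) x].
Proof.
congr (fine (D _)); apply/seteqP; split=> x /=; rewrite !ltfE.
  by move=> neq; apply/eqP => lE; apply: neq; rewrite lE.
by move=> /eqP neq /bool_natr_inj.
Qed.

Lemma disagreeCE r c : disagree D (ltf r0 c0) (fun x => 1 - ltf r c x) =
  pr D [set x : Rd d | label (r0, c0) x == label (r, c) x].
Proof.
have ltfC x : 1 - ltf r c x = (~~ label (r, c) x)%:R.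
  by rewrite ltfE; case: label; rewrite ?subrr ?subr0.
congr (fine (D _)); apply/seteqP; split=> x /=; rewrite ltfC ltfE.
  by move=> neq; apply/eqP; apply: contra_notP neq; case: label; case: label.
by move=> /eqP -> /bool_natr_inj; case: label.
Qed.

Lemma disagree_of_recovers r c (q k : nat) (eta : R) (balanced : bool) :
  (balanced -> k.*2 = q) ->
  recovers D (label (r0, c0)) eta balanced (label (r, c)) ->
  (k%:R != q%:R / 2 :> R -> disagree D (ltf r0 c0) (ltf r c) <= eta) /\
  (k%:R = q%:R / 2 :> R ->
    disagree D (ltf r0 c0) (ltf r c) <= eta \/
    disagree D (ltf r0 c0) (fun x => 1 - ltf r c x) <= eta).
Proof.
rewrite disagreeE disagreeCE => balancedE [agree|[/balancedE <- disagree]].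
  by split=> // _; left.
split=> [|_]; last by right.
by rewrite -addnn natrD => /eqP[]; lra.
Qed.

Lemma classes_dim_gt0 :
  (forall b, 0 < pr D [set x | label (r0, c0) x = b]) -> (0 < d)%N.
Proof.
move=> class_gt0; have inhabited b : exists x : Rd d, label (r0, c0) x = b.
  apply/not_existsP => none; have := class_gt0 b.
  rewrite (_ : [set x | _] = set0) ?pr_set0 ?ltxx//.
  by apply/seteqP; split=> x // /none.
rewrite lt0n; apply/eqP => d0; subst d.
have [x] := inhabited true; have [y] := inhabited false.
by rewrite /label /score !big_ord0 => ->.
Qed.

Lemma bag_avg_eq (q k : nat) r c (bag : 'I_q -> Rd d) : (0 < q)%N ->
  (bag_avg (ltf r c) bag == k%:R / q%:R) = ((\sum_j label (r, c) (bag j))%N == k).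
Proof.
move=> q0; rewrite /bag_avg RdivE (eq_bigr _ (fun j _ => ltfE r c (bag j))) -natr_sum.
by rewrite (can_eq (divfK _)) ?eqr_nat// pnatr_eq0 -lt0n.
Qed.

Lemma bag_err_misses (q k m : nat) r c (eps : R) (bags : 'I_m -> 'I_q -> Rd d) :
  (0 < q)%N -> bag_err k (ltf r c) bags <= eps ->
  (bag_misses k (label (r, c)) bags)%:R <= eps * m%:R.
Proof.
move=> q0; case: m bags => [|m] bags; first by rewrite /bag_misses big_ord0 mulr0.
rewrite /bag_err RdivE ler_pdivrMr ?ltr0n//; congr (_%:R <= _).
rewrite -sum1_card big_mkcond; apply: eq_bigr => i _; rewrite -(bag_avg_eq k r c)//.
rewrite (_ : (i \in _) = (bag_avg (ltf r c) (bags i) != k%:R / q%:R)).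
  by case: eqP.
by apply/idP/idP; rewrite inE.
Qed.

Lemma label_class_gt0 :
  (0 < D [set x | ltf r0 c0 x = 1%R])%E -> (0 < D [set x | ltf r0 c0 x = 0%R])%E ->
  forall b, 0 < pr D [set x | label (r0, c0) x = b].
Proof.
move=> D1 D0 b; rewrite -lte_fin EFin_pr; last first.
  exact: (measurable_fun_fiber b (measurable_label (r0, c0))).
by rewrite -ltf_fiber; case: b.
Qed.

Definition positives (q k : nat) : {set 'I_q} := finset (fun j : 'I_q => (j < k)%N).

Lemma card_positives (q k : nat) : (k <= q)%N -> #|positives q k| = k.
Proof.
move=> kq; rewrite -sum1dep_card -(big_ord_widen _ (fun=> 1%N) kq).
by rewrite sum1_card card_ord.
Qed.

Section OracleSample.
Context {dO : measure_display} {O : measurableType dO} (P : probability O R).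
Variables (q k m : nat) (X : 'I_m -> 'I_q -> O -> Rd d).
Hypothesis class_gt0 : forall b, 0 < pr D [set x | label (r0, c0) x = b].
Hypothesis kq : (0 < k < q)%N.
Hypothesis XP : bags_from_oracle P D (ltf r0 c0) k X.

Lemma positives_proper : (0 < #|positives q k| < #|'I_q|)%N.
Proof. by have /andP[k0 kq'] := kq; rewrite card_positives ?card_ord ?k0// ltnW. Qed.

Lemma product_law_of_oracle : product_law P X
  (fun j => class_conditioned D (measurable_label (r0, c0)) (j \in positives q k)).
Proof.
have [_ [indep law]] := XP => A mA.
rewrite (_ : [set w | _] = [set w | forall p, p \in [set: 'I_m * 'I_q]%SET ->
    A p.1 p.2 (X p.1 p.2 w)]); last first.
  by apply/seteqP; split=> w /= wA => [p _|i j]; [|apply: (wA (i, j)); rewrite inE].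
rewrite /pr indep// pair_big; apply: eq_big => [p|p _]; first by rewrite inE.
rewrite law//= inE -/(pr _ _) pr_conditioned//.
have -> : (if (p.2 < k)%N then 1 else 0) = (p.2 < k)%N%:R :> R by case: ifP.
by rewrite /cond_prob ltf_fiber.
Qed.

Definition fooled_by_rationals (eps : R) : set O :=
  fooled X D (label (r0, c0)) (positives q k)
    (fun n x => label (rational_halfspace R d n) x) (eps * m%:R) (4 * eps).

Lemma measurable_fooled_by_rationals eps : measurable (fooled_by_rationals eps).
Proof.
by have [mX _] := XP; apply: measurable_fooled => // n; exact: measurable_label.
Qed.

Lemma pr_fooled_by_rationals_le (eps t : R) :
  3 <= eps * m%:R -> 4 * eps < 1 / 2 -> 0 < t <= 1 ->
  pr P (fooled_by_rationals eps) <=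
  2 * ((1 + t) ^+ (2 * (m * q)) / t ^+ d.+1) * expR (- (5 / 32 * (eps * m%:R))).
Proof.
move=> em3 e2 t01; have [mX _] := XP.
apply: (pr_fooled_le class_gt0 positives_proper mX product_law_of_oracle) => //.
- by move=> n; exact: measurable_label.
- by rewrite card_ord; lra.
move=> N S y; apply: le_trans (card_label_le y _ _ t01) _.
by rewrite !card_prod card_bool !card_ord.
Qed.

Lemma disagree_of_not_fooled (eps : R) (w : O) r c :
  ~ fooled_by_rationals eps w ->
  bag_err k (ltf r c) (fun i j => X i j w) <= eps ->
  (k%:R != q%:R / 2 :> R -> disagree D (ltf r0 c0) (ltf r c) <= 4 * eps) /\
  (k%:R = q%:R / 2 :> R ->
    disagree D (ltf r0 c0) (ltf r c) <= 4 * eps \/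
    disagree D (ltf r0 c0) (fun x => 1 - ltf r c x) <= 4 * eps).
Proof.
move=> not_fooled; have /andP[k0 /ltnW le_kq] := kq.
move=> /(bag_err_misses (leq_trans k0 le_kq)) few.
apply: (disagree_of_recovers (balanced := #|positives q k|.*2 == #|'I_q|)).
  by rewrite card_positives// card_ord => /eqP.
have [s cvgs] := rational_label_cvg (r, c).
apply: (recovers_of_not_fooled (measurable_label _) _ not_fooled _ cvgs).
- by move=> n; exact: measurable_label.
- exact: measurable_label.
- by rewrite card_positives.
Qed.
End OracleSample.
End Ltf.

Theorem theorem4 :
  exists C0 : R, 0 < C0 /\
  forall (d : nat) (D : probability (Rd d) R) (r0 : 'rV[R]_d) (c0 : R)
         (q k m : nat) (eps delta : R)
         (dO : measure_display) (O : measurableType dO) (P : probability O R)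
         (X : 'I_m -> 'I_q -> O -> Rd d),
    (2 <= q)%N -> (1 <= k <= q.-1)%N ->
    (0 < D [set x | ltf r0 c0 x = 1%R])%E ->
    (0 < D [set x | ltf r0 c0 x = 0%R])%E ->
    0 < eps -> eps < 1 / (4 * q%:R) -> 0 < delta ->
    m%:R >= C0 * d%:R * (ln q%:R + ln (1 / delta)) / eps ^+ 2 ->
    bags_from_oracle P D (ltf r0 c0) k X ->
    exists G : set O, measurable G /\ ((1 - delta)%:E <= P G)%E /\
      forall w, G w ->
        forall h : Rd d -> R, is_ltf h ->
          bag_err k h (fun i j => X i j w) <= eps ->
          (k%:R != q%:R / 2 :> R ->
             disagree D (ltf r0 c0) h <= 4 * eps) /\
          (k%:R = q%:R / 2 :> R ->
             disagree D (ltf r0 c0) h <= 4 * eps \/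
             disagree D (ltf r0 c0) (fun x => 1 - h x) <= 4 * eps).
Proof.
exists 100; split; first by rewrite ltr0n.
move=> d D r0 c0 q k m eps delta dO O P X.
move=> q2 kq D1 D0 eps_gt0 eps_lt delta_gt0 m_ge XP.
have [delta_ge1|/ltW delta_le1] := leP 1 delta.
  exists set0; split; first exact: measurable0.
  by split=> //; rewrite measure0 lee_fin subr_le0.
have delta01 : 0 < delta <= 1 by rewrite delta_gt0.
have class_gt0 := label_class_gt0 D1 D0; have d_gt0 := classes_dim_gt0 class_gt0.
have [eta_lt_half t01] := small_error_bounds q2 eps_gt0 eps_lt.
have [M_ge3 le_delta] := sample_size_suffices d_gt0 q2 eps_gt0 eps_lt delta01 m_ge.
have k_range : (0 < k < q)%N by rewrite -(ltn_predK q2) ltnS.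
have mfooled := measurable_fooled_by_rationals XP eps.
exists (~` fooled_by_rationals D r0 c0 k X eps); split; first exact: measurableC.
split=> [|w not_fooled h [r [c /funext ->]]].
  rewrite probability_setC// -EFin_pr// -EFinB lee_fin lerD2l lerN2.
  have le_bound := pr_fooled_by_rationals_le class_gt0 k_range XP M_ge3 eta_lt_half t01.
  exact: le_trans le_bound le_delta.
exact: disagree_of_not_fooled k_range _ _ _ _ not_fooled.
Qed.
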